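(* Let $(X,d)$ be a metric space and $f:X\to X$ a continuous map. If $(X,f)$ is strongly multi-transitive, then it is strongly multi-sensitive.
   Context: $\mathbb{N}=\{1,2,3,\dots\}$. - For $\alpha=(a_1,\dots,a_r)\in\mathbb{N}^r$, $(X,f)$ is multi-transitive with respect to $\alpha$ if the product system $(X^r, f^{a_1}\times\cdots\times f^{a_r})$ is transitive, where a system $(Y,g)$ is transitive if for all nonempty open $U,V\subseteq Y$ there is $k\in\mathbb{N}$ with $g^k(U)\cap V\neq\emptyset$. $(X,f)$ is strongly multi-transitive if it is multi-transitive with respect to every $\alpha\in\mathbb{N}^r$ for every $r\in\mathbb{N}$. - For a continuous map $g:X\to X$, $U\subseteq X$ and $\delta>0$, let $N_g(U,\delta)=\{k\in\mathbb{N}: \exists x,y\in U \text{ with } d(g^k(x),g^k(y))>\delta\}$. For $n\geq 2$ and $\beta=(m_1,\dots,m_n)\in\mathbb{N}^n$, $(X,f)$ is multi-sensitive with respect to $\beta$ if there is $\delta>0$ such that for all nonempty open $U_1,\dots,U_n\subseteq X$, $\bigcap_{i=1}^n N_{f^{m_i}}(U_i,\delta)\neq\emptyset$. $(X,f)$ is strongly multi-sensitive if it is multi-sensitive with respect to every $\beta\in\mathbb{N}^n$ for every $n\geq2$.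
   Formalization: The space X is additionally assumed not to consist of a single point: a one-point system is strongly multi-transitive but never multi-sensitive, so the claim fails there. *)

(* Defs.v *)
From HB Require Import structures.
From mathcomp Require Import all_boot all_order all_algebra.
From mathcomp Require Import all_classical all_reals all_analysis.

Set Implicit Arguments.
Unset Strict Implicit.
Unset Printing Implicit Defensive.

Import Order.TTheory GRing.Theory Num.Theory.

Local Open Scope classical_set_scope.
Local Open Scope ring_scope.

(* Times k, exponents a_i, m_i and lengths r range over the positive integers,
   hence the explicit positivity conditions on nat below. *)

Definition transitive_system (Y : topologicalType) (g : Y -> Y) : Prop :=
  forall U V : set Y, open U -> open V -> U !=set0 -> V !=set0 ->
  exists2 k : nat, (0 < k)%N & (iter k g @` U) `&` V !=set0.

Definition power_space (X : topologicalType) (r : nat) : topologicalType :=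
  prod_topology (fun _ : 'I_r => X).

Definition power_map (X : topologicalType) (f : X -> X) (r : nat)
    (alpha : 'I_r -> nat) : power_space X r -> power_space X r :=
  fun x i => iter (alpha i) f (x i).

Definition multi_transitive (X : topologicalType) (f : X -> X) (r : nat)
    (alpha : 'I_r -> nat) : Prop :=
  transitive_system (power_map f alpha).

Definition strongly_multi_transitive (X : topologicalType) (f : X -> X) : Prop :=
  forall (r : nat) (alpha : 'I_r -> nat),
  (0 < r)%N -> (forall i, (0 < alpha i)%N) -> multi_transitive f alpha.

Definition sensitivity_times (R : realType) (X : metricType R) (g : X -> X)
    (U : set X) (delta : R) : set nat :=
  [set k | (0 < k)%N /\
    exists x y, [/\ U x, U y & delta < mdist (iter k g x) (iter k g y)]].

Definition multi_sensitive (R : realType) (X : metricType R) (f : X -> X)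
    (n : nat) (beta : 'I_n -> nat) : Prop :=
  exists2 delta : R, 0 < delta &
  forall U : 'I_n -> set X, (forall i, open (U i)) -> (forall i, U i !=set0) ->
  \bigcap_i sensitivity_times (iter (beta i) f) (U i) delta !=set0.

Definition strongly_multi_sensitive (R : realType) (X : metricType R)
    (f : X -> X) : Prop :=
  forall (n : nat) (beta : 'I_n -> nat),
  (2 <= n)%N -> (forall i, (0 < beta i)%N) -> multi_sensitive f beta.

(* Main.v *)
Require Import Defs.
From mathcomp Require Import all_boot all_order all_algebra.
From mathcomp Require Import all_classical all_reals all_analysis.
From mathcomp Require Import lra.

Local Open Scope classical_set_scope.

(* Fix two distinct points a and b.  Transitivity of the product system for
   the doubled exponent vector (beta, beta), applied to the boxes
   U_1 x ... x U_n x U_1 x ... x U_n and B(a)^n x B(b)^n with B(a), B(b) small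
   balls, gives one time k at which every U_i contains a point sent near a and
   a point sent near b by the k-th iterate of f^{beta_i}. *)

(** Finiteness of ['I_r] is essential: a neighbourhood of [x] in the product topology can impose
    only finitely many coordinate conditions. *)
Lemma open_box (X : topologicalType) (r : nat) (A : 'I_r -> set X) :
  (forall i, open (A i)) ->
  open [set x : power_space X r | forall i, A i (x i)].
Proof.
move=> oA; rewrite openE => x Ax.
apply: (filter_forall (F := nbhs x) (nbhs_filter x)) => i.
exact: (@proj_continuous 'I_r (fun=> X) i x _ (open_nbhs_nbhs (conj (oA i) (Ax i)))).
Qed.

Lemma iter_power_map (X : topologicalType) (f : X -> X) (r : nat)
    (alpha : 'I_r -> nat) (k : nat) (x : power_space X r) (i : 'I_r) :
  iter k (power_map f alpha) x i = iter k (iter (alpha i) f) (x i).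
Proof. by elim: k => //= k <-. Qed.

Lemma multi_transitive_box (X : topologicalType) (f : X -> X) (r : nat)
    (alpha : 'I_r -> nat) (A B : 'I_r -> set X) :
  multi_transitive f alpha ->
  (forall i, open (A i)) -> (forall i, open (B i)) ->
  (forall i, A i !=set0) -> (forall i, B i !=set0) ->
  exists2 k, (0 < k)%N & forall i, exists2 x, A i x &
    B i (iter k (iter (alpha i) f) x).
Proof.
move=> tf oA oB /choice[a Aa] /choice[b Bb].
have [] := tf _ _ (open_box _ _ _ oA) (open_box _ _ _ oB); [by exists a|by exists b|].
move=> k k0 [_ [[x Ax <-] Bx]]; exists k => // i; exists (x i); first exact: Ax.
by have := Bx i; rewrite iter_power_map.
Qed.

(** Used to double exponents and source sets, and to pair the two targets, through equations on each
    half alone. *)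
Lemma ex_ord_halves (X : Type) (n : nat) (U V : 'I_n -> X) :
  exists W : 'I_(n + n) -> X,
    (forall i, W (lshift n i) = U i) /\ (forall i, W (rshift n i) = V i).
Proof.
exists (fun j => match fintype.split j with inl i => U i | inr i => V i end).
by split=> i; [have := unsplitK (inl i : 'I_n + 'I_n)|
               have := unsplitK (inr i : 'I_n + 'I_n)] => /= ->.
Qed.

Lemma strongly_multi_transitive_hit2 (X : topologicalType) (f : X -> X)
    (n : nat) (beta : 'I_n -> nat) (U : 'I_n -> set X) (A B : set X) :
  strongly_multi_transitive f -> (0 < n)%N -> (forall i, (0 < beta i)%N) ->
  (forall i, open (U i)) -> (forall i, U i !=set0) ->
  open A -> A !=set0 -> open B -> B !=set0 ->
  exists2 k, (0 < k)%N & forall i, exists x y,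
    [/\ U i x, U i y, A (iter k (iter (beta i) f) x) &
        B (iter k (iter (beta i) f) y)].
Proof.
move=> tf n0 beta0 oU U0 oA A0 oB B0.
have [alpha [alphal alphar]] := ex_ord_halves _ _ beta beta.
have [W [Wl Wr]] := ex_ord_halves _ _ U U.
(* Coordinates [i] and [n + i] share exponent and source set; only their targets differ, [A] against
   [B]. *)
have [V [Vl Vr]] := ex_ord_halves _ n (fun=> A) (fun=> B).
have halves (P : 'I_(n + n) -> Prop) : (forall i, P (lshift n i)) ->
    (forall i, P (rshift n i)) -> forall j, P j.
  by move=> Pl Pr j; rewrite -(splitK j); case: fintype.split.
have [|||||k k0 hk] := @multi_transitive_box X f (n + n) alpha W V.
- apply: tf; first by rewrite addn_gt0 n0.
  by apply: halves => i; rewrite ?alphal ?alphar.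
- by apply: halves => i; rewrite ?Wl ?Wr.
- by apply: halves => i; rewrite ?Vl ?Vr.
- by apply: halves => i; rewrite ?Wl ?Wr.
- by apply: halves => i; rewrite ?Vl ?Vr.
exists k => // i.
have := hk (lshift n i); rewrite alphal Wl Vl => -[x Ux Ax].
have := hk (rshift n i); rewrite alphar Wr Vr => -[y Uy By].
by exists x, y.
Qed.

(* A one-point space is strongly multi-transitive but never multi-sensitive,
   so that degenerate case is excluded. *)
Theorem theorem11 (R : realType) (X : metricType R) (f : X -> X)
    (X_not_point : ~ (exists x0 : X, [set: X] = [set x0]))
    (f_cont : continuous f) :
  strongly_multi_transitive f -> strongly_multi_sensitive f.
Proof.
move=> tf n beta n2 beta0.
have n0 : (0 < n)%N by exact: ltnW.
(* [X] may still be empty. Then no [U i] is nonempty, so any positive constant, here 1, works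
   vacuously. *)
have [[a _]|X0] := pselect ([set: X] !=set0); last first.
  exists 1%R => // U _ U0; case: X0.
  by have [x _] := U0 (Ordinal n0); exists x.
have [b ab] : exists b : X, a != b.
  apply: contrapT => nab; apply: X_not_point; exists a.
  apply/seteqP; split=> // x _ /=; apply: contrapT => xa; apply: nab.
  by exists x; apply/eqP => ax; apply: xa.
have d0 : (0 < mdist a b)%R by rewrite mdist_gt0.
(* If [u] is within [e] of [a] and [v] within [e] of [b], two triangle inequalities leave
   [mdist u v] above [4e - 2e], hence above [e]. *)
set e := (mdist a b / 4)%R.
have e0 : (0 < e)%R by rewrite /e; lra.
(* Interiors of balls serve as the open targets. *)
have ball0 (c : X) : (ball c e)° !=set0 by exists c; exact: nbhsx_ballx.
have ballP (c x : X) : (ball c e)° x -> (mdist c x < e)%R.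
  by move/interior_subset; rewrite ballEmdist.
exists e => // U oU U0.
have [k k0 hk] := strongly_multi_transitive_hit2 _ _ _ _ _ _ _ tf n0 beta0 oU U0
  (open_interior (ball a e)) (ball0 a) (open_interior (ball b e)) (ball0 b).
exists k => i _; split=> //.
have [x [y [Ux Uy /ballP ax /ballP byy]]] := hk i.
exists x, y; split=> //.
move: ax byy; set u := iter k _ x; set v := iter k _ y => ax byy.
have := metric_triangle a u b; have := metric_triangle u v b.
rewrite (metric_sym v b) /e in ax byy *; lra.
Qed.
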